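(* Assume that $\mathfrak{S}=\{\sigma_1,\dots,\sigma_p\}$ is finite with $p=|\mathfrak{S}|$. Let $$\mathbf{A}=\mathrm{diag}(A(\sigma_1),\dots,A(\sigma_p))\in\mathbb{R}^{pn\times pn},\qquad \mathbf{B}=\begin{pmatrix}B(\sigma_1)\\ \vdots\\ B(\sigma_p)\end{pmatrix}\in\mathbb{R}^{pn\times m}.$$ Then the system $\partial_t^\alpha x_\sigma(t)=A(\sigma)x_\sigma(t)+B(\sigma)u(t)$, $x_\sigma(0)=x_{0,\sigma}$, is exactly simultaneously controllable in time $T$ if and only if $$\mathrm{rank}\left[\mathbf{B}\;\;\mathbf{A}\mathbf{B}\;\;\cdots\;\;\mathbf{A}^{pn-1}\mathbf{B}\right]=pn.$$
   Context: Setting: $\alpha\in(0,1)$, $T>0$, $n,m\ge 1$, $H=\mathbb{R}^n$ and $U=\mathbb{R}^m$ with their Euclidean structures, $(\mathfrak{S},\mathcal{F},\mu)$ is a probability space, $A(\sigma)\in\mathbb{R}^{n\times n}$, $B(\sigma)\in\mathbb{R}^{n\times m}$ for $\sigma\in\mathfrak{S}$. For a square matrix $M$, $E_\alpha(M)=\sum_{k=0}^\infty \frac{M^k}{\Gamma(\alpha k+1)}$ and $E_{\alpha,\alpha}(M)=\sum_{k=0}^\infty \frac{M^k}{\Gamma(\alpha k+\alpha)}$. Here $\partial_t^\alpha$ is the left Caputo derivative $\partial_t^\alpha g(t)=\frac{1}{\Gamma(1-\alpha)}\int_0^t (t-s)^{-\alpha}g'(s)\,ds$. For $x_{0,\sigma}\in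 H$ and $u\in L^\infty(0,T;U)$ (with $u$ independent of $\sigma$) the solution of the system is, for $t\in[0,T]$, $$x_\sigma(t;x_{0,\sigma};u)=E_\alpha(t^\alpha A(\sigma))x_{0,\sigma}+\int_0^t (t-s)^{\alpha-1}E_{\alpha,\alpha}((t-s)^\alpha A(\sigma))B(\sigma)u(s)\,ds.$$ The system is exactly simultaneously controllable in time $T$ if for every $x_{0,\bullet},x_{1,\bullet}\in L^2(\mathfrak{S},H;\mu)$ there exists $u\in L^\infty(0,T;U)$ such that $x_\sigma(T;x_{0,\sigma};u)=x_{1,\sigma}$ for $\mu$-a.e. $\sigma\in\mathfrak{S}$.
   Formalization: The formal theorem additionally assumes that every singleton {σ} is measurable and has positive μ-mass; without this the ''only if'' direction fails (e.g. a σ of measure zero with A(σ)=B(σ)=0 is ignored by the a.e. condition but lowers the rank). *)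

(* Defs.v *)
From HB Require Import structures.
From mathcomp Require Import all_boot all_order all_algebra.
From mathcomp Require Import all_classical all_reals all_analysis.

Set Implicit Arguments.
Unset Strict Implicit.
Unset Printing Implicit Defensive.

Import Order.TTheory GRing.Theory Num.Theory.
Import numFieldNormedType.Exports.

Local Open Scope classical_set_scope.
Local Open Scope ring_scope.

Definition Gamma {R : realType} (x : R) : R :=
  \int[lebesgue_measure]_(t in `]0, +oo[) (t `^ (x - 1) * expR (- t)).

(* The two-parameter Mittag-Leffler function of a square matrix; the series
   converges in the normed space of matrices.  The one-parameter function
   E_a is E_(a, 1). *)
Definition mittag_leffler {R : realType} {n : nat} (a b : R) (M : 'M[R]_n) :
    'M[R]_n :=
  limn (series (fun k : nat => (Gamma (a * k%:R + b))^-1 *: M ^+ k)).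

(* The norm that the library puts on matrices is the maximum norm. *)
Definition euclidean_norm {R : realType} {n : nat} (v : 'cV[R]_n) : R :=
  Num.sqrt (\sum_(i < n) v i 0 ^+ 2).

(* Membership in L^q(X; R^k) for the measure mu; Rocq functions represent their
   almost-everywhere classes. *)
Definition vec_Lfun {d : measure_display} {X : measurableType d} {R : realType}
    (mu : {measure set X -> \bar R}) (q : \bar R) {k : nat}
    (f : X -> 'cV[R]_k) : Prop :=
  (forall i : 'I_k, measurable_fun setT (fun x => f x i 0)) /\
  finite_norm mu q (fun x => euclidean_norm (f x)).

(* L^oo(0, T; R^m), with controls extended (arbitrarily, but measurably) to the
   whole line: the restricted measure ignores what happens off ]0, T[. *)
Definition admissible_control {R : realType} (T : R) {m : nat}
    (u : R -> 'cV[R]_m) : Prop :=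
  vec_Lfun (mrestr lebesgue_measure (measurable_itv `]0, T[)) +oo%E u.

(* The solution at time t of D^alpha x = A x + B u, x(0) = x0, with D^alpha the
   left Caputo derivative, given by the variation-of-constants formula.  The
   vector-valued integral is taken entrywise. *)
Definition frac_solution {R : realType} {n m : nat} (alpha : R)
    (A : 'M[R]_n) (B : 'M[R]_(n, m)) (x0 : 'cV[R]_n) (u : R -> 'cV[R]_m)
    (t : R) : 'cV[R]_n :=
  mittag_leffler alpha 1 (t `^ alpha *: A) *m x0 +
  \col_i \int[lebesgue_measure]_(s in `[0, t])
    ((t - s) `^ (alpha - 1) *:
      (mittag_leffler alpha alpha ((t - s) `^ alpha *: A) *m B *m u s)) i 0.

Definition exactly_simultaneously_controllable {R : realType}
    {d : measure_display} {S : measurableType d} (mu : probability S R)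
    {n m : nat} (alpha : R) (A : S -> 'M[R]_n) (B : S -> 'M[R]_(n, m))
    (T : R) : Prop :=
  forall x0 x1 : S -> 'cV[R]_n,
    vec_Lfun mu 2%:E x0 -> vec_Lfun mu 2%:E x1 ->
    exists2 u : R -> 'cV[R]_m, admissible_control T u &
      {ae mu, forall s, frac_solution alpha (A s) (B s) (x0 s) u T = x1 s}.

Definition kalman_matrix {R : realType} {N m : nat} (A : 'M[R]_N)
    (B : 'M[R]_(N, m)) (K : nat) : 'M[R]_(N, \sum_(k < K) m) :=
  \mxrow_(k < K) (A ^+ k *m B).

(* Main.v *)
Require Import Defs.
From HB Require Import structures.
From mathcomp Require Import all_boot all_order all_algebra.
From mathcomp Require Import all_classical all_reals all_analysis.
From mathcomp Require Import measurable_realfun ess_sup_inf ring lra.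

(* Stacking the finitely many systems gives a single system (A, B) driven by u,
   whose reachable set from 0 is a linear subspace of R^(pn): since every point of
   the parameter space is an atom, almost everywhere means everywhere.  A row
   vector v kills all A^k B iff it kills the first pn of them (Cayley-Hamilton),
   and then it kills the Mittag-Leffler kernel, hence every reachable state; so
   controllability forces full rank.  Conversely, if no v <> 0 kills all A^k B,
   then z |-> v E_(alpha,alpha)(z A) B is a nonzero entire function of z, so it
   does not vanish for small z > 0; hence the Gramian with weight
   (T - s)^(alpha - 1) is nonsingular, and bounded controls built from the kernel
   itself reach every state. *)

Set Implicit Arguments.
Unset Strict Implicit.
Unset Printing Implicit Defensive.

Import Order.TTheory GRing.Theory Num.Theory.
Import numFieldNormedType.Exports.

Local Open Scope classical_set_scope.
Local Open Scope ring_scope.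

(** * Improper integrals and lower bounds for the Gamma function *)

(* An improper integral: [f] may blow up at the endpoints, [F] may not. *)
Lemma integrable_derive_oo {R : realType} (f F : R -> R) (a b C : R) :
  a < b -> {in `]a, b[, continuous f} -> {in `]a, b[, forall x, 0 <= f x} ->
  {in `]a, b[, forall x, is_derive x (1 : R) F (f x)} ->
  {in `]a, b[, forall x, `|F x| <= C} ->
  (@lebesgue_measure R).-integrable `]a, b[ (EFin \o f).
Proof.
move=> ab cf f0 dF FC.
(* With [n.+3] the margin is at most a third of the length, so every [I n] is nondegenerate. *)
pose e (n : nat) : R := (b - a) / n.+3%:R.
pose I n := `[a + e n, b - e n]%classic.
have e0 n : 0 < e n by rewrite divr_gt0// subr_gt0.
have eS n k : (n <= k)%N -> e k <= e n.
  by move=> nk; rewrite ler_wpM2l ?subr_ge0 ?(ltW ab)// lef_pV2 ?posrE// ler_nat.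
have elt n : a + e n < b - e n.
  have k2 : n.+3%:R^-1 < 2^-1 :> R by rewrite ltf_pV2 ?posrE// ltr_nat.
  have d0 : 0 < b - a by rewrite subr_gt0.
  have : e n < (b - a) / 2 by rewrite ltr_pM2l.
  lra.
have Isub n : I n `<=` `]a, b[.
  move=> x; rewrite /I /= !in_itv /= => /andP[h1 h2]; apply/andP; split.
    by apply: (lt_le_trans _ h1); rewrite ltrDl.
  by apply: le_lt_trans h2 _; rewrite ltrBlDr ltrDl.
have mf : measurable_fun `]a, b[%classic f.
  apply: open_continuous_measurable_fun; first exact: interval_open.
  exact/in_continuous_mksetP.
have bigI : \bigcup_n I n = `]a, b[%classic.
  apply/seteqP; split=> [x [n _]|x]; first exact: Isub.
  rewrite /= in_itv/= => /andP[ax xb].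
  have [n hn] : exists n, e n <= Num.min (x - a) (b - x).
    have m0 : 0 < Num.min (x - a) (b - x) by rewrite lt_min !subr_gt0 ax.
    exists (Num.bound ((b - a) / Num.min (x - a) (b - x))).
    rewrite ler_pdivrMr// mulrC -ler_pdivrMr//.
    set y := (b - a) / _.
    have y0 : 0 <= y by rewrite divr_ge0 ?ltW// subr_gt0.
    apply: le_trans (ltW (archi_boundP y0)) _.
    by rewrite ler_nat -addn3 leq_addr.
  exists n => //; rewrite /I/= in_itv/=.
  by move: hn; rewrite le_min => /andP[h1 h2]; apply/andP; split; lra.
apply/integrableP; split; first exact/measurable_EFinP.
have -> : (\int[lebesgue_measure]_(x in `]a, b[) `|(EFin \o f) x|
    = \int[lebesgue_measure]_(x in `]a, b[) (f x)%:E)%E.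
  by apply: eq_integral => x; rewrite inE => xab; rewrite /= ger0_norm// f0.
rewrite -bigI; apply: (@le_lt_trans _ _ (2 * C)%:E); last exact: ltry.
have ndI : nondecreasing_seq I.
  move=> n k nk; rewrite subsetEset => x; rewrite /I /= !in_itv /=.
  by have := eS _ _ nk => ? /andP[? ?]; apply/andP; split; lra.
have mI n : measurable (I n) by exact: measurable_itv.
have mfI n : measurable_fun (I n) (EFin \o f).
  apply/measurable_EFinP; exact: measurable_funS (@Isub n) mf.
have f0I n x : I n x -> (0 <= (EFin \o f) x)%E.
  by move/Isub => xab; rewrite lee_fin f0.
(* Monotone convergence along [I n]: it suffices to bound the proper integrals, each an increment of
   [F] and so at most [2 * C]. *)
have /cvg_lim <- // := @ge0_nondecreasing_set_cvg_integral _ (measurableTypeR R)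
  R I (EFin \o f) lebesgue_measure ndI mI mfI f0I.
apply: lime_le.
  apply: ereal_nondecreasing_is_cvgn.
  exact: (@ge0_nondecreasing_set_nondecreasing_integral _ (measurableTypeR R)
    R I (EFin \o f) lebesgue_measure).
apply: nearW => n; rewrite /I.
have sub x : x \in `](a + e n)%R, (b - e n)%R[ -> x \in `]a, b[.
  move=> xI; apply: (Isub n); rewrite /I /=.
  by apply: subset_itv_oo_cc xI.
have sub' x : x \in `[(a + e n)%R, (b - e n)%R] -> x \in `]a, b[ by exact: Isub.
rewrite (@continuous_FTC2 _ _ F)//.
- rewrite -EFinB lee_fin.
  have /FC h1 : (b - e n) \in `]a, b[ by apply: sub'; rewrite in_itv/= lexx ltW.
  have /FC h2 : (a + e n) \in `]a, b[ by apply: sub'; rewrite in_itv/= lexx ltW.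
  by move: h1 h2; rewrite !ler_norml => /andP[? ?] /andP[? ?]; lra.
- apply: continuous_in_subspaceT => x; rewrite inE => /sub'; exact: cf.
- have cF x : x \in `]a, b[ -> F y @[y --> x] --> F x.
    by move=> /dF [+ _] => /derivable1_diffP/differentiable_continuous.
  split.
  + by move=> x /sub /dF [].
  + by apply: cvg_at_right_filter; apply: cF; apply: sub'; rewrite in_itv/= lexx ltW.
  + by apply: cvg_at_left_filter; apply: cF; apply: sub'; rewrite in_itv/= lexx ltW.
- by move=> x /sub /dF ?; rewrite derive1E derive_val.
Qed.

Lemma integrable_setU {d : measure_display} {X : measurableType d} {R : realType}
    (mu : {measure set X -> \bar R}) (A B : set X) (f : X -> \bar R) :
  measurable A -> measurable B -> mu.-integrable A f -> mu.-integrable B f ->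
  mu.-integrable (A `|` B) f.
Proof.
move=> mA mB iA iB; rewrite -(setDUK (@subsetUl _ A B)).
have mBA : measurable ((A `|` B) `\` A).
  by apply: measurableD => //; exact: measurableU.
have iBA : mu.-integrable ((A `|` B) `\` A) f.
  by apply: integrableS iB => //; move=> x [[]].
move: iA iBA => /integrableP[mfA iA] /integrableP[mfB iBA].
have mfU : measurable_fun (A `|` (A `|` B) `\` A) f by exact/measurable_funU.
apply/integrableP; split => //.
rewrite ge0_integral_setU//; first exact: lte_add_pinfty.
- exact: measurableT_comp.
- by apply/disj_setPS => x [? []].
Qed.

(* Without this, [Gamma x] would be the junk value [fine +oo = 0]. *)
Lemma integrable_Gamma {R : realType} (x : R) : 0 < x ->
  (@lebesgue_measure R).-integrable `]0, +oo[
    (EFin \o (fun t => t `^ (x - 1) * expR (- t))).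
Proof.
move=> x0; pose mu := @lebesgue_measure R.
pose g (t : R) : R := t `^ (x - 1) * expR (- t); rewrite -/g.
have mpow : measurable_fun setT (fun t : R => t `^ (x - 1))
  by exact: measurable_powR.
have mg : measurable_fun setT g.
  apply: measurable_funM => //.
  exact: (measurableT_comp (@measurable_expR R) (@oppr_measurable R setT)).
have mgD (D : set R) : measurable D -> measurable_fun D (EFin \o g).
  by move=> mD; apply/measurable_EFinP; exact: measurable_funTS.
have -> : `]0, +oo[%classic = `]0, 1[ `|` `[1, +oo[ :> set R.
  by rewrite (@itv_bndbnd_setU _ _ _ (BLeft 1))//= bnd_simp.
apply: integrable_setU => //.
  (* Near 0 the exponential is at most 1, and t^x / x is a primitive of the remaining power, bounded
     because x is positive. *)
  apply: (@le_integrable _ _ _ mu _ _ _ (EFin \o (fun t => t `^ (x - 1)))) => //.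
  - exact: mgD.
  - move=> t /=; rewrite in_itv/= => /andP[t0 t1].
    rewrite lee_fin normrM ler_piMr// ger0_norm ?expR_ge0//.
    by rewrite expR_le1 oppr_le0 ltW.
  - apply: (@integrable_derive_oo _ _ (fun t => x^-1 * t `^ x) 0 1 x^-1) => //.
    + move=> t; rewrite in_itv/= => /andP[t0 t1].
      apply: differentiable_continuous; apply/derivable1_diffP.
      by apply: derivable_powR; rewrite in_itv/= t0.
    + by move=> t _; exact: powR_ge0.
    + move=> t; rewrite in_itv/= => /andP[t0 t1].
      have dp := @is_derive1_powR R x t t0.
      by apply: is_derive_eq; rewrite /GRing.scale/= mulrA mulVf ?mul1r ?gt_eqF.
    + move=> t; rewrite in_itv/= => /andP[t0 t1].
      rewrite normrM gtr0_norm ?invr_gt0// ler_piMr ?invr_ge0 ?(ltW x0)//.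
      rewrite ger0_norm ?powR_ge0//.
      rewrite (le_trans (@ge0_ler_powR _ x (ltW x0) t 1 _ _ (ltW t1)))//;
        by rewrite ?nnegrE ?powR1 ?(ltW t0).
(* For t at least 1 the power is below t^(k+1), which a single term of the exponential series bounds
   by M exp(t/2). What remains is a multiple of the exponential density of rate 1/2. *)
have [k hk] : exists k : nat, x - 1 <= k.+1%:R.
  exists (Num.bound `|x - 1|); apply: le_trans (ler_norm _) _.
  by rewrite ltW// (lt_le_trans (archi_boundP _))// ler_nat.
pose M : R := 2 ^+ k.+1 * k.+1`!%:R.
have M0 : 0 <= M by rewrite /M mulr_ge0 ?exprn_ge0.
apply: (@le_integrable _ _ _ mu _ _ _
  (cst (2 * M)%:E \* (EFin \o exponential_pdf (2^-1 : R)))%E) => //.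
- exact: mgD.
- move=> t /=; rewrite in_itv/= andbT => t1; rewrite lee_fin.
  have t0 : 0 < t by apply: lt_le_trans t1.
  rewrite /exponential_pdf patchE mem_set/= ?in_itv/= ?andbT ?(ltW t0)//.
  rewrite !ger0_norm ?mulr_ge0 ?powR_ge0 ?expR_ge0//.
  have h2 : t `^ (x - 1) <= t ^+ k.+1 by rewrite -powR_mulrn ?(ltW t0)// ler_powR.
  have h1 : (t / 2) ^+ k.+1 / k.+1`!%:R <= expR (t / 2).
    apply: le_trans (expR_ge1Dxn k _); first by rewrite lerDr.
    by rewrite divr_ge0 ?ltW.
  have h3 : t ^+ k.+1 <= M * expR (t / 2).
    move: h1; rewrite ler_pdivrMr ?ltr0n ?fact_gt0// expr_div_n.
    rewrite ler_pdivrMr ?exprn_gt0//.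
    by rewrite /M; lra.
  have -> : - 2^-1 * t = t / 2 - t by field.
  rewrite expRD.
  have := ler_wpM2r (expR_ge0 (- t)) (le_trans h2 h3).
  by rewrite /g; lra.
- apply: integrableZl => //.
  apply: (@integrableS _ _ _ mu setT) => //.
  exact: integrable_exponential_pdf.
Qed.

(* Integrate over [L, L+1] only; letting L depend on the radius, this makes the
   Mittag-Leffler coefficients decay faster than any geometric sequence. *)
Lemma Gamma_ge {R : realType} (x L : R) : 0 < x -> 0 < L ->
  L `^ x / (L + 1) * expR (- (L + 1)) <= Gamma x.
Proof.
move=> x0 L0; pose mu := @lebesgue_measure R.
pose g (t : R) : R := t `^ (x - 1) * expR (- t).
have ig : mu.-integrable `]0, +oo[ (EFin \o g) by exact: integrable_Gamma.
have /integrableP[mg _] := ig.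
have g0 t : 0 <= g t by rewrite mulr_ge0 ?powR_ge0 ?expR_ge0.
have sub : `[L, L + 1]%classic `<=` `]0, +oo[%classic.
  by move=> t; rewrite /= !in_itv/= andbT => /andP[+ _]; exact: lt_le_trans.
rewrite -lee_fin /Gamma /Rintegral fineK; last exact: integrable_fin_num ig.
apply: (@le_trans _ _ (\int[mu]_(t in `[L, (L + 1)%R]) (g t)%:E)%E); last first.
  by apply: ge0_subset_integral => // t _; rewrite lee_fin.
set c := leLHS.
apply: (@le_trans _ _ (\int[mu]_(t in `[L, (L + 1)%R]) cst c t)%E).
  rewrite integral_cst// [X in (_ * X)%E]lebesgue_measure_itv/= lte_fin ltrDl ltr01.
  by rewrite -EFinB addrAC subrr add0r mule1.
apply: ge0_le_integral => //.
- by move=> t _; rewrite lee_fin !mulr_ge0 ?powR_ge0 ?expR_ge0 ?invr_ge0//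
    ?addr_ge0// ltW.
- by apply: measurable_funS mg; [exact: measurable_itv|exact: sub].
- move=> t /=; rewrite in_itv/= => /andP[Lt tL]; rewrite lee_fin.
  have t0 : 0 < t by exact: lt_le_trans Lt.
  have L1 : 0 < L + 1 by apply: addr_gt0.
  (* Splitting t^(x-1) as t^x / t allows a bound of numerator and denominator by monotonicity,
     whatever the sign of x - 1. *)
  have -> : g t = t `^ x / t * expR (- t).
    by rewrite /g powRB ?powRr1 ?(ltW t0)// (gt_eqF t0) implybT.
  apply: ler_pM.
  + by rewrite mulr_ge0 ?powR_ge0 ?invr_ge0 ?(ltW L1).
  + exact: expR_ge0.
  + apply: ler_pM; rewrite ?powR_ge0 ?invr_ge0 ?(ltW L1)//.
      by apply: ge0_ler_powR; rewrite ?nnegrE ?(ltW x0) ?(ltW L0) ?(ltW t0).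
    by rewrite lef_pV2 ?posrE.
  + by rewrite ler_expR lerN2.
Qed.

Lemma Gamma_gt0 {R : realType} (x : R) : 0 < x -> 0 < Gamma x.
Proof.
move=> x0; apply: lt_le_trans (Gamma_ge x0 ltr01).
by rewrite !mulr_gt0 ?powR_gt0 ?expR_gt0 ?invr_gt0.
Qed.

(** * Power series with infinite radius of convergence *)

Section entire_pseries.
Context {R : realType}.
Implicit Types (c : R^nat) (z Z : R).

Definition entire c := forall z, cvgn (pseries c z).

(** Convergence at the larger point |z| + 1 forces absolute convergence at z. *)
Lemma entire_norm c : entire c -> entire (fun k => `|c k|).
Proof.
move=> cE z; apply: (@is_cvg_pseries_inside_norm _ c (`|z| + 1) z) => //.
by rewrite [ltRHS]ger0_norm ?addr_ge0// ltrDl.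
Qed.

Lemma le_norm_pseries c z Z : entire c -> `|z| <= Z ->
  `|limn (pseries c z)| <= limn (pseries (fun k => `|c k|) Z).
Proof.
move=> cE zZ; have nE := entire_norm cE.
have eqn x : (fun k => `|c k * x ^+ k|) = (fun k => `|c k| * `|x| ^+ k).
  by apply/funext => k; rewrite normrM normrX.
have nc : cvgn [normed pseries c z].
  by have := nE `|z|; rewrite /pseries /normed_series_of /= /pseries eqn.
apply: le_trans (lim_series_norm nc) _.
rewrite /pseries /normed_series_of /= eqn.
apply: lim_series_le; [exact: nE|exact: nE|] => k.
by rewrite ler_wpM2l// lerXn2r ?nnegrE// (le_trans _ zZ).
Qed.

(** Away from 0 the shifted series is (f(z) - c_0) / z; at 0 its partial sums are eventually
    constant. *)
Lemma entire_shift c : entire c -> entire (fun k => c k.+1).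
Proof.
move=> cE z; have [->|z0] := eqVneq z 0.
  have h : cvgn (series [sequence c k.+1 * 0 ^+ k]_k).
    apply/cvg_ex; exists (c 1%N); rewrite -cvg_shiftS.
    apply: (@cvg_near_cst) => //.
    apply: nearW => n; rewrite /series /= big_nat_recl// expr0 mulr1 big1 ?addr0//.
    by move=> i _; rewrite expr0n mulr0.
  exact: h.
have /cvg_ex[/= l hl] := cE z.
apply/cvg_ex; exists (z^-1 * (l - c 0%N)).
have -> : pseries (fun k => c k.+1) z = (fun n => z^-1 * (pseries c z n.+1 - c 0%N)).
  apply/funext => n; rewrite /pseries /series /= big_nat_recl// expr0 mulr1.
  rewrite addrAC subrr add0r mulr_sumr; apply: eq_bigr => i _.
  by rewrite exprS mulrCA mulKf.
apply: cvgMr; apply: cvgB; last exact: cvg_cst.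
by rewrite -cvg_shiftS in hl.
Qed.

Lemma lim_pseries_recl c z : entire c ->
  limn (pseries c z) = c 0%N + z * limn (pseries (fun k => c k.+1) z).
Proof.
move=> cE; apply/cvg_lim => //; rewrite -cvg_shiftS.
have -> : [sequence pseries c z n.+1]_n
    = (fun n => c 0%N + z * pseries (fun k => c k.+1) z n).
  apply/funext => n; rewrite /pseries /series /= big_nat_recl// expr0 mulr1.
  by rewrite mulr_sumr; congr (_ + _); apply: eq_bigr => i _; rewrite exprS mulrCA.
apply: cvgD; first exact: cvg_cst.
by apply: cvgMr; exact: entire_shift.
Qed.

(** Zeros do not accumulate at 0: factors z are split off until the constant term is nonzero, and
    then that term dominates near 0. *)
Lemma lim_pseries_neq0 c k : entire c -> c k != 0 ->
  exists2 e : R, 0 < e & forall z, 0 < z < e -> limn (pseries c z) != 0.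
Proof.
have base c' : entire c' -> c' 0%N != 0 ->
    exists2 e : R, 0 < e & forall z, 0 < z < e -> limn (pseries c' z) != 0.
  move=> cE c0; set B := limn (pseries (fun k => `|c' k.+1|) 1).
  have B0 : 0 <= B.
    by apply: le_trans (le_norm_pseries (entire_shift cE) (_ : `|0| <= 1));
      rewrite ?normr0.
  have Bp : 0 < B + 1 by rewrite ltr_wpDl.
  (* [B] bounds the shifted series on the unit disc, so z B < |c_0| excludes a zero; [B + 1] avoids
     a division by 0. *)
  exists (Num.min 1 (`|c' 0%N| / (B + 1))).
    by rewrite lt_min ltr01 divr_gt0// normr_gt0.
  move=> z; rewrite lt_min => /and3P[z0 z1]; rewrite ltr_pdivlMr// => zB.
  rewrite lim_pseries_recl//; apply: contraTneq zB => /eqP.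
  rewrite addr_eq0 => /eqP ->; rewrite -leNgt normrN normrM (gtr0_norm z0).
  rewrite ler_pM2l//; apply: (@le_trans _ _ B); last by rewrite lerDl.
  by apply: le_norm_pseries (entire_shift cE) _; rewrite gtr0_norm ?ltW.
elim: k c => [|k IH] c cE ck; first exact: base.
have [c0|c0] := eqVneq (c 0%N) 0; last exact: base.
have [e e0 he] := IH _ (entire_shift cE) ck.
exists e => // z ze; rewrite lim_pseries_recl// c0 add0r mulf_neq0 ?he//.
by case/andP: ze => /gt_eqF ->.
Qed.

Lemma measurable_lim_pseries c : entire c ->
  measurable_fun setT (fun z => limn (pseries c z)).
Proof.
move=> cE; apply: (@measurable_fun_cvg _ _ _ _ (fun n z => pseries c z n)).
  move=> n; apply: measurable_sum => k; exact: measurable_funM.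
by move=> z _; exact: cE.
Qed.

(** Stated as a convergence, it yields both that a finite combination of entire series is entire and
    what its sum is. *)
Lemma cvg_pseries_sum (I : Type) (r : seq I) (c : I -> R^nat) (w : I -> R) z :
  (forall i, entire (c i)) ->
  pseries (fun k => \sum_(i <- r) w i * c i k) z @ \oo -->
    \sum_(i <- r) w i * limn (pseries (c i) z).
Proof.
move=> cE.
have -> : pseries (fun k => \sum_(i <- r) w i * c i k) z
    = (fun n => \sum_(i <- r) w i * pseries (c i) z n).
  apply/funext => n; rewrite /pseries /series /=.
  under [RHS]eq_bigr do rewrite mulr_sumr.
  rewrite exchange_big /=; apply: eq_bigr => k _.
  by rewrite mulr_suml; apply: eq_bigr => i _; rewrite mulrA.
apply: cvg_big => [|i _]; first exact: add_continuous.
apply: cvgMr; exact: cE.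
Qed.

End entire_pseries.

(** * Entries of the Mittag-Leffler function as entire series *)

Section mittag_leffler_entries.
Context {R : realType}.

Lemma cvg_mx {m n : nat} (F : nat -> 'M[R]_(m, n)) (L : 'M[R]_(m, n)) :
  (forall i j, F k i j @[k --> \oo] --> L i j) -> F @ \oo --> L.
Proof.
move=> FL; apply/cvgrPdist_le => /= e e0; near=> k.
rewrite /Num.Def.normr/= mx_normrE (bigmax_le _ (ltW e0))//= => i _.
rewrite !mxE/=; move: i; near: k; apply: filter_forall => /= i.
exact: ((cvgrPdist_le _ _).1 (FL i.1 i.2)).
Unshelve. all: by end_near. Qed.

(** The sum of the absolute values of all entries dominates every row sum, so each further factor
    [A] costs at most that constant. *)
Lemma norm_expmx_le {n : nat} (A : 'M[R]_n) k i j :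
  `|(A ^+ k) i j| <= (\sum_i \sum_l `|A i l|) ^+ k.
Proof.
elim: k i j => [|k IH] i j.
  by rewrite !expr0 mxE; case: eqP; rewrite ?normr1 ?normr0.
rewrite !exprS -[A * _]/(A *m _) mxE.
apply: le_trans (ler_norm_sum _ _ _) _.
rewrite [X in _ <= X * _](bigD1 i)//= mulrDl -[leLHS]addr0 lerD//; last first.
  by rewrite mulr_ge0 ?exprn_ge0 ?sumr_ge0// => ? _; rewrite sumr_ge0.
by rewrite mulr_suml; apply: ler_sum => l _; rewrite normrM ler_wpM2l.
Qed.

Lemma expmxZ {n : nat} (z : R) (A : 'M[R]_n) k : (z *: A) ^+ k = z ^+ k *: A ^+ k.
Proof.
elim: k => [|k IH]; first by rewrite !expr0 scale1r.
rewrite !exprS IH -![in LHS]mulmxE -[in RHS]mulmxE.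
by rewrite -scalemxAl -scalemxAr scalerA.
Qed.

Lemma inv_Gamma_le (a b K : R) : 0 < a -> 0 < b -> 0 < K ->
  exists2 C : R, 0 <= C & forall k : nat, (Gamma (a * k%:R + b))^-1 * K ^+ k <= C.
Proof.
move=> a0 b0 K0; pose L := K `^ a^-1.
have L0 : 0 < L by exact: powR_gt0.
have L1 : 0 < L + 1 by exact: addr_gt0.
pose c := L `^ b / (L + 1) * expR (- (L + 1)).
have c0 : 0 < c by rewrite !mulr_gt0 ?powR_gt0 ?expR_gt0 ?invr_gt0.
exists c^-1 => [|k]; first by rewrite invr_ge0 ltW.
have x0 : 0 < a * k%:R + b by rewrite ltr_wpDl// mulr_ge0 ?(ltW a0).
rewrite mulrC ler_pdivrMr ?Gamma_gt0// mulrC ler_pdivlMr//.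
apply: le_trans (Gamma_ge x0 L0).
rewrite powRD; last by rewrite (gt_eqF L0) implybT.
rewrite /L powRrM -[K `^ a^-1 `^ a]powRrM mulVf ?gt_eqF//.
rewrite powRr1 ?(ltW K0)// powR_mulrn ?(ltW K0)// -/L /c.
by rewrite -!mulrA.
Qed.

(** The Taylor coefficients in z of the entry (i, j) of E_(a,b)(z A) B. *)
Definition ml_coef (a b : R) {n m : nat} (A : 'M[R]_n) (B : 'M[R]_(n, m)) i j k :=
  (Gamma (a * k%:R + b))^-1 * (A ^+ k *m B) i j.

Lemma entire_ml_coef (a b : R) {n m : nat} (A : 'M[R]_n) (B : 'M[R]_(n, m)) i j :
  0 < a -> 0 < b -> entire (ml_coef a b A B i j).
Proof.
move=> a0 b0 z.
have H l : entire (fun k => (Gamma (a * k%:R + b))^-1 * (A ^+ k) i l).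
  move=> {}z.
  set M := \sum_i \sum_l `|A i l|.
  have M0 : 0 <= M by apply: sumr_ge0 => ? _; apply: sumr_ge0.
  have Mz0 : 0 <= 2 * (M * `|z|) by rewrite !mulr_ge0.
  (* The factor 2 leaves a geometric majorant of ratio 1/2; adding 1 keeps the base positive. *)
  have [C C0 hC] := inv_Gamma_le a0 b0 (ltr_wpDl Mz0 ltr01).
  apply: normed_cvg.
  apply: (@series_le_cvg _ _ (geometric C 2^-1)) => //.
  - by move=> k; exact: normr_ge0.
  - by move=> k; rewrite /geometric /= mulr_ge0 ?exprn_ge0 ?invr_ge0.
  - move=> k; rewrite /geometric /=.
    have G0 : 0 < Gamma (a * k%:R + b).
      by apply: Gamma_gt0; rewrite ltr_wpDl// mulr_ge0 ?(ltW a0).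
    rewrite exprVn ler_pdivlMr ?exprn_gt0//.
    apply: le_trans (hC k).
    rewrite !normrM (gtr0_norm (_ : 0 < _^-1)) ?invr_gt0// -!mulrA.
    rewrite ler_pM2l ?invr_gt0// normrX -exprMn.
    apply: le_trans (ler_wpM2r _ (norm_expmx_le A k i l)) _.
      by rewrite exprn_ge0.
    rewrite -/M -exprMn; apply: lerXn2r; rewrite ?nnegrE ?addr_ge0 ?mulr_ge0//.
    by have := mulr_ge0 M0 (normr_ge0 z); lra.
  - by apply: is_cvg_geometric_series; rewrite ger0_norm ?invr_ge0// invf_lt1 ?ltr1n.
have -> : ml_coef a b A B i j = fun k => \sum_l B l j *
    ((Gamma (a * k%:R + b))^-1 * (A ^+ k) i l).
  apply/funext => k; rewrite /ml_coef mxE mulr_sumr; apply: eq_bigr => l _.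
  by rewrite mulrA mulrC.
by apply/cvg_ex; eexists; exact: cvg_pseries_sum.
Qed.

(** The matrix limit is computed entry by entry, with [B] replaced by the identity; multiplying by
    [B] is then a finite combination of entire series. *)
Lemma mittag_lefflerE (a b z : R) {n m : nat} (A : 'M[R]_n) (B : 'M[R]_(n, m)) i j :
  0 < a -> 0 < b ->
  (mittag_leffler a b (z *: A) *m B) i j = limn (pseries (ml_coef a b A B i j) z).
Proof.
move=> a0 b0.
have -> : mittag_leffler a b (z *: A) =
    \matrix_(i, j) limn (pseries (ml_coef a b A 1%:M i j) z).
  apply/cvg_lim => //.
  apply: cvg_mx => {}i {}j; rewrite mxE.
  rewrite [X in X @ _ --> _](_ : _ = pseries (ml_coef a b A 1%:M i j) z).
    exact: entire_ml_coef.
  apply/funext => k; rewrite /pseries /series /= summxE; apply: eq_bigr => l _.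
  by rewrite expmxZ /ml_coef mulmx1 !mxE mulrA mulrAC.
rewrite mxE; under eq_bigr do rewrite mxE mulrC.
apply/esym/cvg_lim => //.
rewrite [X in pseries X _](_ : _ = fun k => \sum_l B l j * ml_coef a b A 1%:M i l k).
  by apply: cvg_pseries_sum => l; exact: entire_ml_coef.
apply/funext => k; rewrite /ml_coef mxE mulr_sumr; apply: eq_bigr => l _.
by rewrite mulmx1 mulrA mulrC.
Qed.

End mittag_leffler_entries.

(** * Integrability of the singular weight against bounded controls *)

Lemma integrable_ae_bounded {d : measure_display} {X : measurableType d}
    {R : realType} (mu : {measure set X -> \bar R}) (D : set X) (f g : X -> R)
    (K : R) : measurable D -> mu.-integrable D (EFin \o f) ->
  measurable_fun D g -> {ae mu, forall x, D x -> `|g x| <= K} ->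
  mu.-integrable D (EFin \o (fun x => f x * g x)).
Proof.
move=> mD fi mg gK; have /integrableP[/measurable_EFinP mf foo] := fi.
have mfg : measurable_fun D (EFin \o (fun x => f x * g x)).
  by apply/measurable_EFinP; exact: measurable_funM.
apply/integrableP; split => //.
(* [K] may be negative when [D] is a null set, hence the maximum with 0. *)
have nfi : (\int[mu]_(x in D) ((Num.max K 0)%:E * `|(f x)%:E|) < +oo)%E.
  rewrite ge0_integralZl//.
  - by apply: lte_mul_pinfty; rewrite ?lee_fin ?le_max ?lexx ?orbT//.
  - by apply: measurableT_comp => //; exact/measurable_EFinP.
  - by rewrite lee_fin le_max lexx orbT.
apply: le_lt_trans nfi; apply: ae_ge0_le_integral => //.
- exact: measurableT_comp.
- by move=> x _; rewrite mule_ge0 ?lee_fin ?le_max ?lexx ?orbT.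
- by apply: measurable_funeM; apply: measurableT_comp => //; exact/measurable_EFinP.
- apply: filterS gK => x + Dx => /(_ Dx) gxK.
  rewrite /= -EFinM lee_fin normrM mulrC ler_wpM2r//.
  by rewrite le_max gxK.
Qed.

Section control.
Context {R : realType}.
Variables (alpha T : R).
Hypotheses (alpha_gt0 : 0 < alpha) (T_gt0 : 0 < T).
Let mu := @lebesgue_measure R.
Let D : set R := `]0, T[.

(** The singularity at s = T is integrable since the primitive -(T - s)^alpha / alpha stays
    bounded. *)
Lemma integrable_kernel :
  mu.-integrable D (EFin \o (fun s => (T - s) `^ (alpha - 1))).
Proof.
apply: (@integrable_derive_oo _ _ (fun s => - (alpha^-1 * (T - s) `^ alpha)) 0 T
  (alpha^-1 * T `^ alpha)) => //.
- move=> s; rewrite in_itv/= => /andP[s0 sT].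
  apply: (@continuous_comp _ _ _ (fun s => T - s) (fun t => t `^ (alpha - 1))).
    by apply: cvgB; [exact: cvg_cst|exact: cvg_id].
  apply: differentiable_continuous; apply/derivable1_diffP.
  by apply: derivable_powR; rewrite in_itv/= subr_gt0 sT.
- by move=> s _; exact: powR_ge0.
- move=> s; rewrite in_itv/= => /andP[s0 sT].
  have Ts : 0 < T - s by rewrite subr_gt0.
  have dp := @is_derive1_powR R alpha (T - s) Ts.
  have dc : is_derive s (1 : R) (fun s => (T - s) `^ alpha)
      (- (alpha * (T - s) `^ (alpha - 1))).
    have di : is_derive s (1 : R) (fun s => T - s) (-1).
      by apply: is_derive_eq; rewrite add0r [LHS]mul1r.
    have := @is_derive1_comp _ (fun t => t `^ alpha) (fun s => T - s) s _ _ dp di.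
    by rewrite mulrN1.
  apply: is_derive_eq; rewrite /GRing.scale/= mulrN opprK mulrA mulVf ?mul1r//.
  by rewrite gt_eqF.
- move=> s; rewrite in_itv/= => /andP[s0 sT].
  have Ts : 0 < T - s by rewrite subr_gt0.
  rewrite normrN ger0_norm ?mulr_ge0 ?invr_ge0 ?powR_ge0 ?(ltW alpha_gt0)//.
  rewrite ler_pM2l ?invr_gt0//; apply: ge0_ler_powR;
    rewrite ?nnegrE ?(ltW alpha_gt0) ?(ltW T_gt0) ?(ltW Ts)//.
  by rewrite gerBl ltW.
Qed.

Lemma ae_admissible_control_le {m : nat} (u : R -> 'cV[R]_m) :
  admissible_control T u ->
  exists C : R, {ae mu, forall s, D s -> forall j, `|u s j 0| <= C}.
Proof.
move=> [_]; rewrite /finite_norm unlock /=.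
set nu := mrestr _ _.
(* The norm of L^oo is the essential supremum only if the whole space has positive measure, and is 0
   by convention otherwise. *)
have nuT : (0 < nu setT)%E.
  rewrite /nu /mrestr setTI; rewrite [ltRHS]lebesgue_measure_itv/= lte_fin T_gt0.
  by rewrite -EFinB lte_fin subr0.
rewrite nuT.
have -> : (abse \o (EFin \o (fun x => euclidean_norm (u x)))) =
    EFin \o (fun x => euclidean_norm (u x)).
  by apply/funext => s; rewrite /= ger0_norm ?sqrtr_ge0.
move=> /ess_supr_bounded[C [N [mN N0 NC]]].
(* A null set of the restricted measure becomes a Lebesgue null set after intersection with [D]. *)
exists C; exists (N `&` D); split => //.
  by apply: measurableI => //; exact: measurable_itv.
move=> s /= /not_implyP[Ds uC]; split => //; apply: NC => /= h; apply: uC => j.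
apply: le_trans h; rewrite /euclidean_norm -sqrtr_sqr ler_sqrt; last first.
  by apply: sumr_ge0 => i _; exact: sqr_ge0.
by rewrite (bigD1 j)//= lerDl sumr_ge0// => i _; exact: sqr_ge0.
Qed.

End control.

Lemma integrable_sum_scaled {d : measure_display} {X : measurableType d}
    {R : realType} (mu : {measure set X -> \bar R}) (D : set X) (I : Type)
    (r : seq I) (w : I -> R) (f : I -> X -> R) : measurable D ->
  (forall i, mu.-integrable D (EFin \o f i)) ->
  mu.-integrable D (EFin \o (fun x => \sum_(i <- r) w i * f i x)).
Proof.
move=> mD fi.
rewrite (_ : _ \o _ = fun x => (\sum_(i <- r) (w i)%:E * (f i x)%:E)%E).
  by apply: integrable_sum => // i _; apply: integrableZl => //; exact: fi.
by apply/funext => x /=; rewrite -sumEFin.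
Qed.

Lemma Rintegral_sum_scaled {d : measure_display} {X : measurableType d}
    {R : realType} (mu : {measure set X -> \bar R}) (D : set X) (I : Type)
    (r : seq I) (w : I -> R) (f : I -> X -> R) : measurable D ->
  (forall i, mu.-integrable D (EFin \o f i)) ->
  \int[mu]_(x in D) (\sum_(i <- r) w i * f i x) =
    \sum_(i <- r) w i * \int[mu]_(x in D) f i x.
Proof.
move=> mD fi; rewrite /Rintegral.
have wfi i : mu.-integrable D (fun x => (w i * f i x)%:E).
  rewrite (_ : (fun x => _) = fun x => ((w i)%:E * (f i x)%:E)%E); last exact/funext.
  by apply: integrableZl => //; exact: fi.
under eq_integral do rewrite -sumEFin.
rewrite (@integral_sum _ _ _ mu D mD _ (fun i x => (w i * f i x)%:E))//.
rewrite -sum_fine; last by move=> i _; exact: integrable_fin_num (wfi i).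
apply: eq_bigr => i _.
rewrite (_ : (\int[mu]_(x in D) (w i * f i x)%:E)%E =
  ((w i)%:E * \int[mu]_(x in D) (f i x)%:E)%E); last first.
  rewrite -integralZl//; exact: fi.
by rewrite fineM// integrable_fin_num//; exact: fi.
Qed.

(** * The state reached from zero and the kernel controls *)

Section response.
Context {R : realType}.
Variables (alpha T : R).
Hypotheses (alpha_gt0 : 0 < alpha) (T_gt0 : 0 < T).
Local Notation mu := (@lebesgue_measure R).
Let D : set R := `]0, T[.

(** The integral term of [frac_solution] at time T, kept in the same form so that the two agree by
    unfolding. *)
Definition forced_response {n m : nat} (A : 'M[R]_n) (B : 'M[R]_(n, m))
    (u : R -> 'cV[R]_m) : 'cV[R]_n :=
  \col_i \int[mu]_(s in `[0, T])
    ((T - s) `^ (alpha - 1) *: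
      (mittag_leffler alpha alpha ((T - s) `^ alpha *: A) *m B *m u s)) i 0.

(** The entry (i, j) of E_(alpha,alpha)((T - s)^alpha A) B, written as a scalar power series. *)
Definition kernel {n m : nat} (A : 'M[R]_n) (B : 'M[R]_(n, m)) i j (s : R) : R :=
  limn (pseries (ml_coef alpha alpha A B i j) ((T - s) `^ alpha)).

Definition weight (s : R) : R := (T - s) `^ (alpha - 1).

Lemma measurable_kernel {n m : nat} (A : 'M[R]_n) (B : 'M[R]_(n, m)) i j :
  measurable_fun setT (kernel A B i j).
Proof.
apply: (measurableT_comp (measurable_lim_pseries _)).
  exact: entire_ml_coef.
apply: (measurableT_comp (@measurable_powR R alpha)).
exact: measurable_funB.
Qed.

(** On [D] the argument (T - s)^alpha lies between 0 and T^alpha, where the series of absolute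
    values gives the bound. *)
Lemma kernel_le {n m : nat} (A : 'M[R]_n) (B : 'M[R]_(n, m)) i j :
  exists C : R, forall s, D s -> `|kernel A B i j s| <= C.
Proof.
exists (limn (pseries (fun k => `|ml_coef alpha alpha A B i j k|) (T `^ alpha))).
move=> s; rewrite /D /= in_itv/= => /andP[s0 sT].
apply: le_norm_pseries; first exact: entire_ml_coef.
rewrite ger0_norm ?powR_ge0//; apply: ge0_ler_powR;
  by rewrite ?nnegrE ?(ltW alpha_gt0) ?(ltW T_gt0) ?subr_ge0 ?(ltW sT)// gerBl ltW.
Qed.

Lemma integrable_forced {n m : nat} (A : 'M[R]_n) (B : 'M[R]_(n, m)) u i :
  admissible_control T u ->
  mu.-integrable D
    (EFin \o (fun s => weight s * \sum_j kernel A B i j s * u s j 0)).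
Proof.
move=> hu; have [C uC] := ae_admissible_control_le T_gt0 hu.
have /choice[K hK] : forall j, exists C : R,
    forall s, D s -> `|kernel A B i j s| <= C.
  by move=> j; exact: kernel_le.
apply: (@integrable_ae_bounded _ _ _ mu D weight _ (\sum_j K j * C)).
- exact: measurable_itv.
- exact: integrable_kernel.
- apply: measurable_funTS; apply: measurable_sum => j; apply: measurable_funM.
    exact: measurable_kernel.
  by case: hu => + _; exact.
- case: uC => N [mN N0 NC]; exists N; split => // s /= h; apply: NC => /= uCs.
  apply: h => Ds.
  apply: le_trans (ler_norm_sum _ _ _) _; apply: ler_sum => j _.
  by rewrite normrM; apply: ler_pM => //; [exact: hK|exact: uCs].
Qed.

Lemma forced_responseE {n m : nat} (A : 'M[R]_n) (B : 'M[R]_(n, m)) u i :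
  admissible_control T u ->
  forced_response A B u i 0 =
    \int[mu]_(s in D) (weight s * \sum_j kernel A B i j s * u s j 0).
Proof.
move=> hu; have hi := integrable_forced A B i hu.
rewrite mxE.
have -> : (fun s => ((T - s) `^ (alpha - 1) *:
      (mittag_leffler alpha alpha ((T - s) `^ alpha *: A) *m B *m u s)) i 0)
    = (fun s => weight s * \sum_j kernel A B i j s * u s j 0).
  apply/funext => s; rewrite !mxE; congr (_ * _); apply: eq_bigr => j _.
  by rewrite mittag_lefflerE.
rewrite -Rintegral_itv_obnd_cbnd; first by rewrite -Rintegral_itv_bndo_bndc.
(* Dropping the endpoint 0 requires integrability on ]0, T], obtained from [D] by adding the null
   set {T}. *)
have oc : `]0%R, T]%classic `<=` D `|` [set T].
  move=> s; rewrite /D /= !in_itv/= => /andP[->]; rewrite le_eqVlt => /orP[/eqP|] ->.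
    by right.
  by left.
apply: (@integrableS _ (measurableTypeR R) _ mu (D `|` [set T])) => //.
  by apply: measurableU; [exact: measurable_itv|exact: measurable_set1].
apply: (@integrable_setU _ (measurableTypeR R));
  [exact: measurable_itv|exact: measurable_set1|exact: hi|].
apply/integrableP; split.
  exact: measurable_fun_set1.
by rewrite integral_set1.
Qed.

Lemma row_ml_coefE {n m : nat} (A : 'M[R]_n) (B : 'M[R]_(n, m)) (v : 'rV[R]_n) j :
  (fun k => (Gamma (alpha * k%:R + alpha))^-1 * (v *m (A ^+ k *m B)) 0 j) =
  (fun k => \sum_i v 0 i * ml_coef alpha alpha A B i j k).
Proof.
apply/funext => k; rewrite mxE mulr_sumr; apply: eq_bigr => i _.
by rewrite /ml_coef mulrCA.
Qed.

Lemma entire_row_ml_coef {n m : nat} (A : 'M[R]_n) (B : 'M[R]_(n, m))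
    (v : 'rV[R]_n) j :
  entire (fun k => (Gamma (alpha * k%:R + alpha))^-1 * (v *m (A ^+ k *m B)) 0 j).
Proof.
move=> z; rewrite row_ml_coefE; apply/cvg_ex; eexists.
by apply: cvg_pseries_sum => i; exact: entire_ml_coef.
Qed.

(** Pairing the kernel with [v] gives again a power series in (T - s)^alpha, whose coefficients are
    positive multiples of the entries of v A^k B. *)
Lemma sum_kernelE {n m : nat} (A : 'M[R]_n) (B : 'M[R]_(n, m)) (v : 'rV[R]_n) j s :
  \sum_i v 0 i * kernel A B i j s =
    limn (pseries (fun k => (Gamma (alpha * k%:R + alpha))^-1 *
      (v *m (A ^+ k *m B)) 0 j) ((T - s) `^ alpha)).
Proof.
apply/esym/cvg_lim => //; rewrite row_ml_coefE.
by apply: cvg_pseries_sum => i; exact: entire_ml_coef.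
Qed.

Lemma sum_forced_integrand {n m : nat} (A : 'M[R]_n) (B : 'M[R]_(n, m))
    (v : 'rV[R]_n) (u : R -> 'cV[R]_m) s :
  \sum_i v 0 i * (weight s * \sum_j kernel A B i j s * u s j 0) =
  weight s * \sum_j (\sum_i v 0 i * kernel A B i j s) * u s j 0.
Proof.
under [in RHS]eq_bigr do rewrite mulr_suml.
rewrite exchange_big/= mulr_sumr; apply: eq_bigr => i _.
rewrite mulrCA; congr (_ * _); rewrite mulr_sumr; apply: eq_bigr => j _.
by rewrite mulrA.
Qed.

Lemma mul_forced_response {n m : nat} (A : 'M[R]_n) (B : 'M[R]_(n, m))
    (v : 'rV[R]_n) u : admissible_control T u ->
  (v *m forced_response A B u) 0 0 =
    \int[mu]_(s in D)
      (weight s * \sum_j (\sum_i v 0 i * kernel A B i j s) * u s j 0).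
Proof.
move=> hu; rewrite mxE; under eq_bigr do rewrite forced_responseE//.
rewrite -Rintegral_sum_scaled; last 2 first.
- exact: measurable_itv.
- by move=> i; exact: integrable_forced.
by apply: eq_Rintegral => s _; exact: sum_forced_integrand.
Qed.

(** All coefficients of the series for v E B vanish, so the integrand is zero for every control:
    reachable states lie in the kernel of [v]. *)
Lemma forced_response_ortho {n m : nat} (A : 'M[R]_n) (B : 'M[R]_(n, m))
    (v : 'rV[R]_n) u : admissible_control T u ->
  (forall k, v *m (A ^+ k *m B) = 0) -> v *m forced_response A B u = 0.
Proof.
move=> hu v0; apply/matrixP => i j; rewrite !ord1 mul_forced_response// mxE.
rewrite (@eq_Rintegral _ _ _ _ _ (cst 0));
  first by rewrite Rintegral_cst ?mul0r//; exact: measurable_itv.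
move=> s _ /=; rewrite big1 ?mulr0// => l _; rewrite sum_kernelE.
rewrite [X in pseries X _](_ : _ = fun=> 0); last first.
  by apply/funext => k; rewrite v0 mxE mulr0.
rewrite [X in limn X](_ : _ = cst 0) ?lim_cst ?mul0r//.
by apply/funext => k; rewrite /pseries /series /= big1// => ? _; rewrite mul0r.
Qed.

(** The transpose of c E_(alpha,alpha)((T - s)^alpha A) B. The singular weight is left out, which
    keeps the control bounded; it reappears as the weight of the Gramian. *)
Definition kernel_control {n m : nat} (A : 'M[R]_n) (B : 'M[R]_(n, m))
  (c : 'rV[R]_n) (s : R) : 'cV[R]_m := \col_j \sum_i c 0 i * kernel A B i j s.

Lemma admissible_kernel_control {n m : nat} (A : 'M[R]_n) (B : 'M[R]_(n, m)) c :
  admissible_control T (kernel_control A B c).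
Proof.
split.
  move=> j; rewrite (_ : (fun _ => _) = fun s => \sum_i c 0 i * kernel A B i j s).
    apply: measurable_sum => i; apply: measurable_funM => //.
    exact: measurable_kernel.
  by apply/funext => s; rewrite mxE.
rewrite /finite_norm unlock /=; case: ifP => // _.
have /choice[K hK] : forall j, exists C : R, forall s, D s ->
    `|kernel_control A B c s j 0| <= C.
  move=> j.
  have /choice[K hK] : forall i, exists C : R,
      forall s, D s -> `|kernel A B i j s| <= C.
    by move=> i; exact: kernel_le.
  exists (\sum_i `|c 0 i| * K i) => s Ds; rewrite mxE.
  apply: le_trans (ler_norm_sum _ _ _) _; apply: ler_sum => i _.
  by rewrite normrM ler_wpM2l// hK.
apply: (@le_lt_trans _ _ (Num.sqrt (\sum_j K j ^+ 2))%:E); last exact: ltry.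
(* The pointwise bound holds on [D] only, and the restricted measure does not see the complement. *)
apply/ess_supP; exists (~` D); split.
- by apply: measurableC; exact: measurable_itv.
- by rewrite [LHS](_ : _ = mu (~` D `&` D))// setICl measure0.
- move=> s /=; apply: contra_not => Ds.
  rewrite lee_fin ger0_norm ?sqrtr_ge0// /euclidean_norm.
  rewrite ler_sqrt; last by apply: sumr_ge0 => j _; exact: sqr_ge0.
  apply: ler_sum => j _; rewrite -real_normK ?num_real//.
  by rewrite lerXn2r ?nnegrE// ?(le_trans _ (hK j s Ds))// hK.
Qed.

(** A zero integral would make [g] vanish almost everywhere, but ]a, T[ has positive measure.
    Positivity is asked near T only, where the kernel is known not to vanish. *)
Lemma Rintegral_gt0 (g : R -> R) (a : R) : a < T -> 0 <= a ->
  mu.-integrable D (EFin \o g) -> (forall s, 0 <= g s) ->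
  (forall s, a < s < T -> 0 < g s) -> 0 < \int[mu]_(s in D) g s.
Proof.
move=> aT a0 ig g0 gpos; rewrite lt_neqAle Rintegral_ge0// andbT.
apply/eqP => /esym I0.
have /integrableP[mg _] := ig.
have : (\int[mu]_(s in D) `|(EFin \o g) s| = 0)%E.
  under eq_integral do rewrite /= ger0_norm//.
  rewrite -[LHS]fineK; first by congr (_%:E); exact: I0.
  by apply: integrable_fin_num ig; exact: measurable_itv.
move=> /(ae_eq_integral_abs mu (measurable_itv _) mg)[N [mN N0 NC]].
have sub : `]a, T[ `<=` N.
  move=> s; rewrite /= in_itv/= => /andP[as_ sT]; apply: NC => /= gs.
  have /gs[] : D s by rewrite /D /= in_itv/= sT (le_lt_trans a0).
  by move=> gs0; have := gpos s; rewrite as_ sT gs0 ltxx => /(_ isT).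
have : (mu `]a, T[ <= mu N)%E by apply: le_measure; rewrite ?inE.
rewrite N0 [leLHS]lebesgue_measure_itv/= lte_fin aT -EFinB lee_fin.
by rewrite leNgt subr_gt0 aT.
Qed.

End response.

(** * The weighted Gramian and surjectivity of the response *)

Section gramian.
Context {R : realType}.
Variables (alpha T : R).
Hypotheses (alpha_gt0 : 0 < alpha) (T_gt0 : 0 < T).
Local Notation mu := (@lebesgue_measure R).
Local Notation D := (`]0, T[%classic : set R).

(** A nonzero entry of c A^k B is, up to a positive factor, a nonzero Taylor coefficient, so the
    series has no zero at small positive arguments, that is for s close to T. *)
Lemma kernel_control_neq0 {n m : nat} (A : 'M[R]_n) (B : 'M[R]_(n, m))
    (c : 'rV[R]_n) k : c *m (A ^+ k *m B) != 0 ->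
  exists a : R, [/\ 0 <= a, a < T & forall s, a < s < T ->
    exists j, kernel_control alpha T A B c s j 0 != 0].
Proof.
move=> /rV0Pn[j cj].
have G0 : Gamma (alpha * k%:R + alpha) != 0.
  by rewrite gt_eqF// Gamma_gt0// ltr_wpDl// mulr_ge0 ?(ltW alpha_gt0).
have cE := @entire_row_ml_coef R alpha alpha_gt0 n m A B c j.
have [|e e0 he] := @lim_pseries_neq0 _ _ k cE; first by rewrite mulf_neq0 ?invr_eq0.
(* The series is evaluated at (T - s)^alpha, so arguments below e correspond to T - s <
   e^(1/alpha). *)
pose d := e `^ alpha^-1.
have d0 : 0 < d by exact: powR_gt0.
exists (Num.max 0 (T - d)); split.
- by rewrite le_max lexx.
- by rewrite gt_max T_gt0 ltrBlDr ltrDl.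
- move=> s; rewrite gt_max => /andP[/andP[s0 ds] sT].
  have Ts : 0 < T - s by rewrite subr_gt0.
  exists j; rewrite mxE sum_kernelE// he// powR_gt0//=.
  have -> : e = d `^ alpha.
    by rewrite /d -powRrM mulVf ?gt_eqF// powRr1// ltW.
  by apply: gt0_ltr_powR; rewrite ?nnegrE ?(ltW d0) ?(ltW Ts)//; lra.
Qed.

(** Linearity in [c], expressed on the basis vectors in order to read the response as a product with
    a fixed matrix. *)
Lemma forced_response_kernel_control {n m : nat} (A : 'M[R]_n) (B : 'M[R]_(n, m))
    (c : 'rV[R]_n) :
  forced_response alpha T A B (kernel_control alpha T A B c) =
  \sum_l c 0 l *: forced_response alpha T A B
                    (kernel_control alpha T A B (delta_mx 0 l)).
Proof.
apply/colP => i; rewrite summxE.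
have hu l := @admissible_kernel_control R alpha T alpha_gt0 T_gt0 n m A B
  (delta_mx 0 l).
have E l := forced_responseE alpha_gt0 T_gt0 A B i (hu l).
under [RHS]eq_bigr do rewrite mxE E.
rewrite forced_responseE//; last exact: admissible_kernel_control.
rewrite -Rintegral_sum_scaled; last 2 first.
- exact: measurable_itv.
- by move=> l; exact: integrable_forced (hu l).
apply: eq_Rintegral => s _.
under [RHS]eq_bigr do rewrite mulrCA.
rewrite -mulr_sumr; congr (_ * _).
under [RHS]eq_bigr do rewrite mulr_sumr.
rewrite exchange_big/=; apply: eq_bigr => j _.
rewrite mxE mulr_sumr; apply: eq_bigr => l _.
rewrite mulrCA; congr (_ * (_ * _)).
rewrite mxE (bigD1 l)//= mxE !eqxx mul1r big1 ?addr0// => i' /negbTE i'l.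
by rewrite mxE i'l andbF mul0r.
Qed.

(* [c G c^T] is the weighted L^2 norm of the kernel control associated with [c],
   so the Gramian [G] is nonsingular as soon as no [c] kills every [A^k B]. *)
Lemma forced_response_surj {n m : nat} (A : 'M[R]_n) (B : 'M[R]_(n, m))
    (y : 'cV[R]_n) :
  (forall v : 'rV[R]_n, (forall k, v *m (A ^+ k *m B) = 0) -> v = 0) ->
  exists2 u, admissible_control T u & forced_response alpha T A B u = y.
Proof.
move=> AB0.
(* Row l is the transposed response to the control of the l-th basis vector, so [c] acts on the
   left. *)
pose G := \matrix_(l, i) forced_response alpha T A B
                    (kernel_control alpha T A B (delta_mx 0 l)) i 0.
have GE c : (forced_response alpha T A B (kernel_control alpha T A B c))^T = c *m G.
  rewrite forced_response_kernel_control; apply/rowP => i; rewrite !mxE summxE.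
  by apply: eq_bigr => l _; rewrite !mxE.
have Gfree : row_free G.
  apply/inj_row_free => c cG; apply: AB0 => k; apply/eqP/negP => /negP ck.
  have [a [a0 aT ca]] := kernel_control_neq0 ck.
  have hu := @admissible_kernel_control R alpha T alpha_gt0 T_gt0 n m A B c.
  set u := kernel_control _ _ _ _ c in hu ca.
  (* If c G = 0, the pairing of [c] with its own response vanishes; yet it is the weighted integral
     of |u|^2, which is positive. *)
  have : (c *m forced_response alpha T A B u) 0 0 = 0.
    by rewrite -[forced_response _ _ _ _ _]trmxK GE cG trmx0 mulmx0 mxE.
  rewrite mul_forced_response//; apply/eqP; rewrite gt_eqF//.
  have eqg s : weight alpha T s *
        \sum_j (\sum_i c 0 i * kernel alpha T A B i j s) * u s j 0 =
      weight alpha T s * \sum_j u s j 0 ^+ 2.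
    by congr (_ * _); apply: eq_bigr => j _; rewrite expr2 /u
      [kernel_control _ _ _ _ _ _ _ _]mxE.
  under eq_Rintegral do rewrite eqg.
  apply: (@Rintegral_gt0 R T _ a) => //.
  - rewrite (_ : (fun _ => _) = fun s => \sum_i c 0 i *
        (weight alpha T s * \sum_j kernel alpha T A B i j s * u s j 0)).
      apply: integrable_sum_scaled => [|i]; first exact: measurable_itv.
      exact: integrable_forced.
    by apply/funext => s; rewrite sum_forced_integrand eqg.
  - move=> s; rewrite mulr_ge0 ?powR_ge0// sumr_ge0// => j _; exact: sqr_ge0.
  - move=> s /[dup] /andP[_ sT] /ca[j uj].
    apply: mulr_gt0; first by rewrite /weight powR_gt0// subr_gt0.
    rewrite (bigD1 j)//= ltr_pwDl//; first by rewrite exprn_even_gt0.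
    by apply: sumr_ge0 => ? _; exact: sqr_ge0.
exists (kernel_control alpha T A B (y^T *m invmx G)).
  exact: admissible_kernel_control.
by apply: trmx_inj; rewrite GE mulmxKV// -row_free_unit.
Qed.

End gramian.

(** * The Kalman rank condition in terms of row vectors *)

Lemma mulmx_trmx_eq0 {R : realDomainType} {N : nat} (v : 'rV[R]_N) :
  v *m v^T = 0 -> v = 0.
Proof.
move=> /matrixP/(_ 0 0)/eqP; rewrite !mxE; under eq_bigr do rewrite mxE -expr2.
rewrite psumr_eq0 => [/allP vv|i _]; last exact: sqr_ge0.
apply/rowP => i; rewrite mxE; apply/eqP; rewrite -sqrf_eq0.
by apply: vv; rewrite mem_index_enum.
Qed.

Lemma row_mul_expmx_eq0 {R : realType} {N m : nat} (A : 'M[R]_N) (B : 'M[R]_(N, m))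
    (v : 'rV[R]_N) :
  (forall k, (k < N)%N -> v *m (A ^+ k *m B) = 0) ->
  forall k, v *m (A ^+ k *m B) = 0.
Proof.
case: N A B v => [|N] A B v v0 k; first by rewrite thinmx0 mul0mx.
have CH : A ^+ N.+1 = - \sum_(j < N.+1) (char_poly A)`_j *: A ^+ j.
  have := Cayley_Hamilton A.
  rewrite -[X in horner_mx _ X]coefK poly_def size_char_poly big_ord_recr/=.
  rewrite raddfD/= raddf_sum/= linearZ/= rmorphXn/= horner_mx_X.
  have /monicP := char_poly_monic A; rewrite lead_coefE size_char_poly/= => ->.
  rewrite scale1r => /eqP; rewrite addrC addr_eq0 => /eqP ->; congr (- _).
  by apply: eq_bigr => j _; rewrite linearZ/= rmorphXn/= horner_mx_X.
have [l] := ubnP k; elim: l k => // l IH k kl.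
have [/v0//|Nk] := ltnP k N.+1.
(* Cayley-Hamilton turns A^k into a combination of strictly lower powers, covered by the induction
   hypothesis. *)
rewrite -(subnK Nk) exprD CH mulrN mulr_sumr mulNmx mulmxN mulmx_suml mulmx_sumr.
apply/eqP; rewrite oppr_eq0; apply/eqP/big1 => j _.
rewrite -scalerAr -exprD -scalemxAl -scalemxAr IH ?scaler0//.
by apply: (@leq_trans k) => //; rewrite -[leqRHS](subnK Nk) ltn_add2l.
Qed.

(** Blockwise, a row vector in the left kernel kills the first [K] products A^k B. [K] is separate
    from [N] because the stacked size is a sum equal, but not convertible, to [p * n]. *)
Lemma row_free_kalmanP {R : realType} {N m : nat} (A : 'M[R]_N) (B : 'M[R]_(N, m))
    (K : nat) : (N <= K)%N ->
  row_free (kalman_matrix A B K) <->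
  (forall v : 'rV[R]_N, (forall k, v *m (A ^+ k *m B) = 0) -> v = 0).
Proof.
move=> NK; split=> [rf v v0|H].
  apply/eqP; rewrite -(mulmx_free_eq0 v rf) /kalman_matrix mul_mxrow.
  by apply/eqP; rewrite -[RHS]mxrow0; apply: eq_mxrow => k; exact: v0.
apply: inj_row_free => v; rewrite /kalman_matrix mul_mxrow => v0.
apply: H; apply: row_mul_expmx_eq0 => k kN.
have kK : (k < K)%N := leq_trans kN NK.
have := congr1 (fun M => submxrow M (Ordinal kK)) v0.
by rewrite /= mxrowK submxrow0.
Qed.

(** * Stacking finitely many systems *)

Lemma mul_exp_mxdiag_mxcol {R : pzSemiRingType} {p : nat} {p_ : 'I_p -> nat}
    {m : nat} (A : forall i, 'M[R]_(p_ i)) (B : forall i, 'M[R]_(p_ i, m)) k :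
  (\mxdiag_i A i) ^+ k *m \mxcol_i B i = \mxcol_i (A i ^+ k *m B i).
Proof.
elim: k => [|k IH].
  by rewrite expr0 mul1mx; apply: eq_mxcol => i; rewrite expr0 mul1mx.
rewrite exprS -mulmxE -mulmxA IH mul_mxdiag_mxcol.
by apply: eq_mxcol => i; rewrite exprS -mulmxE mulmxA.
Qed.

(** Each entry of the stacked kernel has the same Taylor coefficients as the entry of its block,
    since powers of a block-diagonal matrix act blockwise. *)
Lemma forced_response_mxcol {R : realType} {p n m : nat} (alpha T : R)
    (A : 'I_p -> 'M[R]_n) (B : 'I_p -> 'M[R]_(n, m)) u :
  0 < alpha -> 0 < T -> admissible_control T u ->
  forced_response alpha T (\mxdiag_i A i) (\mxcol_i B i) u =
  \mxcol_i forced_response alpha T (A i) (B i) u.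
Proof.
move=> a0 T0 hu; apply/colP => x.
rewrite [RHS]mxE !forced_responseE//; apply: eq_Rintegral => s _.
congr (_ * _); apply: eq_bigr => j _; congr (_ * _).
rewrite /kernel; congr (limn (pseries _ _)); apply/funext => k.
by rewrite /ml_coef mul_exp_mxdiag_mxcol mxE.
Qed.

(** Every subset is a finite union of measurable singletons, so any function is measurable; it takes
    finitely many values, hence is bounded, and the measure is finite. *)
Lemma vec_Lfun_finite {d : measure_display} {S : measurableType d} {R : realType}
    (mu : probability S R) {p n : nat} (sigma : 'I_p -> S) (f : S -> 'cV[R]_n) :
  bijective sigma -> (forall s : S, measurable [set s]) -> vec_Lfun mu 2%:E f.
Proof.
move=> [tau sK tK] hm.
have mS (X : set S) : measurable X.
  rewrite (_ : X = \bigcup_(i in [set i | X (sigma i)]) [set sigma i]).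
    by apply: fin_bigcup_measurable.
  apply/seteqP; split => [s Xs|s [i Xi ->]//].
  by exists (tau s) => /=; rewrite tK.
split=> [i|]; first by move=> _ Y _; exact: mS.
rewrite /finite_norm unlock /=; apply: poweR_lty.
pose C := \sum_i euclidean_norm (f (sigma i)).
have fC s : euclidean_norm (f s) <= C.
  rewrite -[s in leLHS]tK /C (bigD1 (tau s))//= lerDl sumr_ge0// => i _.
  exact: sqrtr_ge0.
apply: (@le_lt_trans _ _ (\int[mu]_s cst (C `^ 2)%:E s)%E).
  apply: ge0_le_integral => //.
  move=> s _; rewrite /= lee_fin; apply: ge0_ler_powR => //;
    rewrite ?nnegrE ?(ger0_norm (sqrtr_ge0 _))//.
  - by apply: le_trans (fC s); exact: sqrtr_ge0.
  - exact: fC.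
by rewrite integral_cst// [X in (_ * X)%E](_ : _ = 1%E) ?mule1 ?ltry//;
  exact: probability_setT.
Qed.

Theorem proposition4p6 (R : realType) (alpha T : R)
  (halpha : 0 < alpha < 1) (hT : 0 < T)
  (n m : nat) (hn : (1 <= n)%N) (hm : (1 <= m)%N)
  (d : measure_display) (S : measurableType d) (mu : probability S R)
  (A : S -> 'M[R]_n) (B : S -> 'M[R]_(n, m))
  (p : nat) (sigma : 'I_p -> S) (hsigma : bijective sigma)
  (hmeas : forall s : S, measurable [set s])
  (hmu : forall s : S, (0 < mu [set s])%E) :
  exactly_simultaneously_controllable mu alpha A B T <->
  \rank (kalman_matrix (\mxdiag_(i < p) A (sigma i))
                       (\mxcol_(i < p) B (sigma i)) (p * n)) = (p * n)%N.
Proof.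
have /andP[a0 _] := halpha; have [tau sK tK] := hsigma.
have Npn : (\sum_(i < p) n)%N = (p * n)%N by rewrite sum_nat_const card_ord.
set bA := \mxdiag_(_ < p) _; set bB := \mxcol_(_ < p) _.
have -> : (\rank (kalman_matrix bA bB (p * n)) = (p * n)%N) <->
    row_free (kalman_matrix bA bB (p * n)).
  by rewrite -[X in _ = X]Npn; split=> /eqP.
rewrite row_free_kalmanP ?Npn//.
have resp u i : admissible_control T u ->
    forced_response alpha T (A (sigma i)) (B (sigma i)) u
    = submxcol (forced_response alpha T bA bB u) i.
  by move=> hu; rewrite forced_response_mxcol// mxcolK.
split=> [ctrl v v0|AB0 x0 x1 _ _].
(* Steering the zero state to the blocks of v^T makes v^T reachable for the stacked system. *)
- have [u hu ae1] := ctrl (fun=> 0) (fun s => submxcol v^T (tau s))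
    (vec_Lfun_finite mu _ hsigma hmeas) (vec_Lfun_finite mu _ hsigma hmeas).
  have vu : forced_response alpha T bA bB u = v^T.
    apply/mxcolP => i; rewrite -resp//.
    (* A parameter at which the target is missed would be an atom of positive measure inside a null
       set. *)
    case: ae1 => N [mN N0 NC]; apply: contrapT => h.
    have /NC sN : (~` [set s | frac_solution alpha (A s) (B s) 0 u T
        = submxcol v^T (tau s)]) (sigma i).
      by rewrite /= sK /frac_solution mulmx0 add0r.
    have := hmu (sigma i); rewrite ltNge => /negP; apply; rewrite -N0.
    by apply: le_measure; rewrite ?inE// => _ ->.
  (* [v] kills every reachable state, in particular v^T itself, so v v^T = 0. *)
  by apply: mulmx_trmx_eq0; rewrite -vu; exact: forced_response_ortho.
(* The control has to supply the difference between the target and the free evolution of each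
   block. *)
- have [u hu hy] := forced_response_surj a0 hT (\mxcol_i (x1 (sigma i) -
     mittag_leffler alpha 1 (T `^ alpha *: A (sigma i)) *m x0 (sigma i))) AB0.
  exists u => //; apply: aeW => s; rewrite -(tK s).
  rewrite /frac_solution -/(forced_response alpha T _ _ _).
  by rewrite resp// hy mxcolK addrC subrK.
Qed.
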